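(* Let $d\ge1$. Assume that $b=A\nabla v$ in $Y_d$, where $A\in C^1_\sharp(Y_d)^{d\times d}$ is a matrix-valued function with $A(y)=A(y)^T\geq0$ (symmetric nonnegative) for all $y\in Y_d$, and $v\in C^2_\sharp(Y_d)$. Let $X(\cdot,x)$ be the solution of $\frac{\partial X}{\partial t}(t,x)=b(X(t,x))$, $t\in\mathbb{R}$, $X(0,x)=x\in\mathbb{R}^d$. Then $$\forall\,x\in\mathbb{R}^d,\quad\lim_{t\to\infty}\frac{X(t,x)}{t}=0.$$
   Context: $Y_d:=\mathbb{R}^d/\mathbb{Z}^d$ is the $d$-dimensional torus, identified with the cube $[0,1)^d$. $C^k_\sharp(Y_d)$ is the space of real-valued functions in $C^k(\mathbb{R}^d)$ which are $\mathbb{Z}^d$-periodic. For $b\in C^1_\sharp(Y_d)^d$ the solution $X(\cdot,x)$ exists on all of $\mathbb{R}$, is unique, and takes values in $\mathbb{R}^d$. *)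

(* Defs.v *)
From mathcomp Require Import all_boot all_order all_algebra.
From mathcomp Require Import all_classical all_reals all_analysis.

Set Implicit Arguments.
Unset Strict Implicit.
Unset Printing Implicit Defensive.

Import Order.TTheory GRing.Theory Num.Theory.
Import numFieldNormedType.Exports.

Local Open Scope classical_set_scope.
Local Open Scope ring_scope.

Section torus.
Context {R : realType} {d : nat}.
Implicit Types (f v : 'cV[R]_d -> R).

Definition basis_vec (i : 'I_d) : 'cV[R]_d := delta_mx i 0.

Definition partial (i : 'I_d) f : 'cV[R]_d -> R :=
  fun x => 'D_(basis_vec i) f x.

Definition grad v : 'cV[R]_d -> 'cV[R]_d := fun x => \col_i partial i v x.

(* All iterated partial derivatives of order at most k exist everywhere
   and are continuous. *)
Fixpoint Ck (k : nat) f : Prop :=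
  if k is k'.+1 then
    continuous f /\
    forall i : 'I_d,
      (forall x, derivable f x (basis_vec i)) /\ Ck k' (partial i f)
  else continuous f.

Definition Zperiodic f : Prop :=
  forall (m : 'cV[int]_d) (x : 'cV[R]_d),
    f (x + map_mx (fun z : int => z%:~R) m) = f x.

(* Functions on the torus R^d / Z^d are represented by Z^d-periodic functions
   on R^d. *)
Definition Ck_per (k : nat) f : Prop := Ck k f /\ Zperiodic f.

Definition Ck_per_mx (k : nat) (A : 'cV[R]_d -> 'M[R]_d) : Prop :=
  forall i j, Ck_per k (fun y => A y i j).

Definition sym_nonneg (M : 'M[R]_d) : Prop :=
  M^T = M /\ forall xi : 'cV[R]_d, 0 <= (xi^T *m M *m xi) 0 0.

Definition is_flow (b : 'cV[R]_d -> 'cV[R]_d) (X : R -> 'cV[R]_d -> 'cV[R]_d)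
    : Prop :=
  forall x, X 0 x = x /\
    forall t : R, is_derive t 1 (fun s : R => X s x) (b (X t x)).

End torus.

(* Main.v *)
From HB Require Import structures.
Require Import Defs.
From mathcomp Require Import all_boot all_order all_algebra.
From mathcomp Require Import all_classical all_reals all_analysis.
From mathcomp Require Import lra.

(** Along a trajectory the potential [v] grows at the rate
    [w = grad v . A grad v >= 0], so the integral of [w] over [0, t] is at most
    the oscillation of [v], which is finite because [v] is continuous and
    periodic.  Positivity of [A] makes [w] control the speed: expanding
    [(grad v - s e_i) . A (grad v - s e_i) >= 0] gives
    [2 s b_i <= w + s^2 A_ii] for every real [s] ([sym_nonneg_coord_le]).
    Integrating, with [|v| <= M] and [A_ii <= C],
    [2 s (X_i(t) - x_i) <= 2 M + s^2 C t]; the two choices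
    [s = 1 / sqrt t] and [s = - 1 / sqrt t] balance the terms and yield
    [|X_i(t) - x_i| <= (M + C / 2) sqrt t] ([displacement_rate_le]).  The
    displacement is thus of order [sqrt t], and [X(t) / t] tends to [0].

    The integration is carried out by applying the mean value theorem to
    [v(X(t)) - 2 s X_i(t) + s^2 C t], whose derivative is nonnegative.  This
    requires the chain rule for [v] along a curve, hence that continuous partial
    derivatives imply Frechet differentiability ([Ck1_differentiable]). *)

Set Implicit Arguments.
Unset Strict Implicit.
Unset Printing Implicit Defensive.

Import Order.TTheory GRing.Theory Num.Theory.
Import numFieldNormedType.Exports.

Local Open Scope classical_set_scope.
Local Open Scope ring_scope.

(** * Entries of matrices: norm, limits, derivatives *)

Lemma mx_norm_coord (K : realDomainType) (m n : nat) (M : 'M[K]_(m, n)) i j :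
  `|M i j| <= `|M|.
Proof.
by rewrite [leRHS]/Num.Def.normr/= mx_normrE; exact: (le_bigmax _ _ (i, j)).
Qed.

Lemma mx_norm_le (K : realDomainType) (m n : nat) (M : 'M[K]_(m, n)) (c : K) :
  0 <= c -> (forall i j, `|M i j| <= c) -> `|M| <= c.
Proof.
move=> c0 Mc; rewrite [leLHS]/Num.Def.normr/= mx_normrE.
by apply: bigmax_le => // -[i j] _; exact: Mc.
Qed.

Lemma trmx_continuous (T : topologicalType) m n :
  continuous (@trmx T m n).
Proof.
move=> M B /= [P MP sPB]; exists (fun i j => P j i) => [i j|N PN].
  by have := MP j i; rewrite mxE.
by apply: sPB => i j; rewrite mxE; exact: PN.
Qed.

Lemma cvg_mx_coord (T : Type) (R : topologicalType) (m n : nat)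
    (F : set_system T) (f : T -> 'M[R]_(m, n)) (l : 'M[R]_(m, n)) : Filter F ->
  (forall i j, f t i j @[t --> F] --> l i j) -> f t @[t --> F] --> l.
Proof.
move=> FF fl B /= [P lP PB].
have : \forall t \near F, forall i j, P i j (f t i j).
  by apply: filter_forall => i; apply: filter_forall => j; exact: fl (lP i j).
by apply: filterS => t Pt; exact: PB.
Qed.

Lemma is_derive_coord (R : realFieldType) (V : normedModType R) (m n : nat)
    (gamma : V -> 'M[R]_(m, n)) (t e : V) (dgamma : 'M[R]_(m, n)) i j :
  is_derive t e gamma dgamma ->
  is_derive t e (fun s => gamma s i j) (dgamma i j).
Proof.
move=> [dg dgE]; split; first exact: (derivable_mxP _ _ _).1.
by rewrite -dgE derive_mx// mxE.
Qed.

(** * Continuous partial derivatives imply differentiability *)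

Lemma is_derive_line (R : realType) (V : normedModType R) (f : V -> R)
    (y e : V) (r : R) :
  derivable f (r *: e + y) e ->
  is_derive r 1 (fun s : R => f (s *: e + y)) ('D_e f (r *: e + y)).
Proof.
have E : (fun h : R => h^-1 *: (((fun s : R => f (s *: e + y)) \o shift r)
             (h *: (1 : R)) - f (r *: e + y)))
   = (fun h : R => h^-1 *: ((f \o shift (r *: e + y)) (h *: e)
             - f (r *: e + y))).
  by apply/funext => h /=; rewrite [h *: 1]mulr1 scalerDl addrA.
by move=> df; split; rewrite ?/derivable ?/derive ?E.
Qed.

(** The mean value theorem on the segment from [y] to [s *: e + y], for either
    sign of [s].  It turns closeness of the directional derivative to [c] into a
    first-order estimate of the increment that is uniform in [y]. *)
Lemma line_increment_le (R : realType) (V : normedModType R) (f : V -> R)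
    (y e : V) (c eps s : R) :
  (forall z, derivable f z e) ->
  (forall r : R, `|r| <= `|s| -> `|'D_e f (r *: e + y) - c| <= eps) ->
  `|f (s *: e + y) - f y - s * c| <= eps * `|s|.
Proof.
move=> df hc.
have dg (r : R) :
    is_derive r 1 (fun s : R => f (s *: e + y)) ('D_e f (r *: e + y)).
  exact/is_derive_line/df.
have cg (a b : R) : {within `[a, b], continuous (fun s : R => f (s *: e + y))}.
  by apply: derivable_within_continuous => r _; exact: ex_derive.
suff [r rs ->] : exists2 r : R, `|r| <= `|s| &
    f (s *: e + y) - f y = 'D_e f (r *: e + y) * s.
  by rewrite mulrC -mulrBr normrM mulrC ler_wpM2r// hc.
have [s0|/ltW s0] := leP 0 s.
  have [r + E] := MVT_segment s0 (fun r _ => dg r) (cg _ _).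
  rewrite in_itv/= => /andP[r0 rs]; exists r; first by rewrite !ger0_norm.
  by move: E; rewrite scale0r add0r subr0.
have [r + E] := MVT_segment s0 (fun r _ => dg r) (cg _ _).
rewrite in_itv/= => /andP[sr r0]; exists r; first by rewrite !ler0_norm// lerN2.
by move: E; rewrite scale0r add0r sub0r mulrN -opprB => /oppr_inj.
Qed.

(** The points [truncate h 0 = 0], ..., [truncate h d = h] form a path whose steps
    are parallel to the axes, so that along each step only one partial derivative
    is involved. *)
Definition truncate {R : realType} {d : nat} (h : 'cV[R]_d) (k : nat)
    : 'cV[R]_d :=
  \col_i (if (i < k)%N then h i 0 else 0).

Lemma truncateS (R : realType) (d : nat) (h : 'cV[R]_d) (i : 'I_d) :
  truncate h i.+1 = h i 0 *: basis_vec i + truncate h i.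
Proof.
apply/colP => j; rewrite !mxE eqxx andbT ltnS leq_eqVlt -val_eqE.
by case: eqVneq => [/val_inj->|_] /=; rewrite ?ltnn ?mulr1 ?addr0 ?mulr0 ?add0r.
Qed.

(** In the sup norm the whole path stays in the ball of radius [`|h|], where the
    partial derivatives are close to their values at the centre. *)
Lemma truncate_norm (R : realType) (d : nat) (h : 'cV[R]_d) (i : 'I_d) (r : R) :
  `|r| <= `|h i 0| -> `|r *: basis_vec i + truncate h i| <= `|h|.
Proof.
move=> rh; apply: mx_norm_le => // j k; rewrite !mxE !ord1 eqxx andbT.
have [->|_] := eqVneq.
  by rewrite ltnn mulr1 addr0 (le_trans rh)// mx_norm_coord.
by rewrite mulr0 add0r; case: ifP => _; rewrite ?normr0// mx_norm_coord.
Qed.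

Section C1.
Context {R : realType} {d : nat}.
Variables (f : 'cV[R]_d -> R) (x : 'cV[R]_d).
Hypothesis f1 : Ck 1 f.

Definition grad_form : 'cV[R]_d -> R :=
  fun h => \sum_i h i 0 * partial i f x.

Let grad_form_linear : linear grad_form.
Proof.
move=> a h k; rewrite /grad_form scaler_sumr -big_split/=.
by apply: eq_bigr => i _; rewrite !mxE mulrDl -mulrA.
Qed.

HB.instance Definition _ := GRing.isLinear.Build _ _ _ _ grad_form
  grad_form_linear.

Let grad_form_continuous : continuous grad_form.
Proof.
have term_continuous i : continuous (fun h : 'cV[R]_d => h i 0 * partial i f x).
  move=> h; apply: cvgM; first exact: nbhs_filter.
    exact: coord_continuous.
  exact: cst_continuous.
apply: continuous_big => [|i _]; first exact: add_continuous.
exact: term_continuous.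
Qed.

(** The increment of [f] is telescoped along the axis-parallel path; each step
    deviates from its linear part by at most [e' * `|h|], by continuity of the
    partial derivatives. *)
Let grad_form_littleo :
  f \o shift x = cst (f x) + grad_form +o_ (0 : 'cV[R]_d) id.
Proof.
apply/eqaddoP => _/posnumP[eps].
(* The d steps each contribute e' * `|h|; dividing by d.+1 rather than d avoids
   the case d = 0. *)
pose e' : R := eps%:num / d.+1%:R.
have e'0 : 0 < e' by rewrite divr_gt0.
have near_partial : \forall z \near (0 : 'cV[R]_d), forall i : 'I_d,
    `|partial i f (z + x) - partial i f x| <= e'.
  apply: (@filter_forall _ _ _ (nbhs (0 : 'cV[R]_d)) _ _) => i.
  have ci : {for x, continuous (partial i f)} by have [_ /(_ i)[_]] := f1; apply.
  have [r /= r0 hr] := (nbhs_normP _ _).1 ((cvgrPdist_le _ _).1 ci _ e'0).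
  apply: (nbhs_normP (0 : 'cV[R]_d) _).2; exists r => //= z.
  rewrite /ball_/= sub0r normrN => zr; rewrite distrC; apply: hr.
  by rewrite /ball_/= opprD addrCA subrr addr0 normrN.
have [delta /= delta0 hdelta] := (nbhs_normP _ _).1 near_partial.
apply: (nbhs_normP (0 : 'cV[R]_d) _).2; exists delta => //= h.
rewrite /ball_/= sub0r normrN => hd.
rewrite -![(_ + _ : _ -> _) _]/(_ + _) /=.
have -> : f (h + x) - (f x + grad_form h) =
  \sum_(i < d) (f (truncate h i.+1 + x) - f (truncate h i + x)
                - h i 0 * partial i f x).
  rewrite sumrB opprD addrA -/(grad_form h); congr (_ - _).
  rewrite -(big_mkord xpredT
    (fun k => f (truncate h k.+1 + x) - f (truncate h k + x))).
  rewrite telescope_sumr//; congr (f _ - f _).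
    by congr (_ + x); apply/colP => i; rewrite !mxE ltn_ord.
  apply/esym; rewrite -[RHS]add0r; congr (_ + x).
  by apply/colP => i; rewrite !mxE.
apply: (le_trans (ler_norm_sum _ _ _)).
apply: (@le_trans _ _ (\sum_(i < d) e' * `|h|)).
  apply: ler_sum => i _; rewrite truncateS -[_ + _ + x]addrA.
  apply: (@le_trans _ _ (e' * `|h i 0|)).
    apply: line_increment_le => [z|r rh]; first by have [_ /(_ i)[]] := f1.
    rewrite addrA; apply: hdelta => /=; rewrite sub0r normrN.
    by apply: le_lt_trans hd; exact: truncate_norm.
  by apply: ler_wpM2l; [exact: ltW|exact: mx_norm_coord].
rewrite sumr_const card_ord -[X in _ <= X]/(eps%:num * `|h|) -mulr_natr mulrAC.
apply: ler_wpM2r => //; rewrite /e' mulrAC ler_pdivrMr//.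
by apply: ler_wpM2l => //; rewrite ler_nat.
Qed.

Lemma Ck1_differentiable : differentiable f x.
Proof.
apply/diff_locallyP.
have := diff_unique grad_form_continuous grad_form_littleo.
by move=> ->; split; [exact: grad_form_continuous|exact: grad_form_littleo].
Qed.

Lemma Ck1_diffE (h : 'cV[R]_d) : 'd f x h = ((grad f x)^T *m h) 0 0.
Proof.
rewrite (diff_unique grad_form_continuous grad_form_littleo) mxE.
by apply: eq_bigr => i _; rewrite !mxE mulrC.
Qed.

End C1.

Lemma is_derive_comp_curve (R : realType) (d : nat) (f : 'cV[R]_d -> R)
    (gamma : R -> 'cV[R]_d) (t : R) (dgamma : 'cV[R]_d) :
  Ck 1 f -> is_derive t 1 gamma dgamma ->
  is_derive t 1 (f \o gamma) (((grad f (gamma t))^T *m dgamma) 0 0).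
Proof.
move=> f1 [/derivable1_diffP dg dgE].
have df := @Ck1_differentiable _ _ _ (gamma t) f1.
have dfg : differentiable (f \o gamma) t by exact: differentiable_comp.
split; first exact/derivable1_diffP.
by rewrite deriveE// diff_comp//= -[X in 'd f _ X]deriveE// dgE Ck1_diffE.
Qed.

(** * Periodic functions and nonnegative matrices *)

(** Translating by the integer vector of floors brings every point into the unit
    cube, which is compact. *)
Lemma Zperiodic_bounded (R : realType) (d : nat) (f : 'cV[R]_d -> R) :
  continuous f -> Zperiodic f -> exists M : R, forall x, `|f x| <= M.
Proof.
move=> cf pf.
pose cube := [set z : 'rV[R]_d | forall i, `[(0 : R), 1]%classic (z ord0 i)].
have cube_compact : compact cube.
  apply: (@rV_compact _ _ (fun=> `[(0 : R), 1]%classic)) => i.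
  exact: segment_compact.
have cg : continuous (fun z : 'rV[R]_d => f z^T).
  move=> z; apply: (@continuous_comp _ _ _ (@trmx R 1 d) f).
    exact: trmx_continuous.
  exact: cf.
have image_compact : compact ((fun z : 'rV[R]_d => f z^T) @` cube).
  by apply: continuous_compact => //; exact: continuous_subspaceT.
have [M [_ /(_ (M + 1)) hM]] := compact_bounded image_compact.
exists (M + 1) => x.
rewrite -(pf (\col_i - Num.floor (x i 0))) -[_ + _]trmxK.
apply: hM; first by rewrite ltrDl.
exists (x + map_mx intr (\col_i - Num.floor (x i 0)))^T => //.
move=> i; rewrite /= in_itv/= !mxE rmorphN/= subr_ge0 floor_le_tmp/=.
by rewrite lerBlDr -[1 in X in _ <= X]/(1%:~R) -intrD addrC ltW// floorD1_gt.
Qed.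

(** Expansion of [(g - s e_i) . M (g - s e_i) >= 0].  Keeping the free parameter
    [s], of any sign, instead of optimising it into the Cauchy-Schwarz inequality
    leaves an estimate that is linear in [M g] and in the energy [g . M g], and
    so can be integrated in time directly. *)
Lemma sym_nonneg_coord_le (R : realType) (d : nat) (M : 'M[R]_d)
    (g : 'cV[R]_d) (i : 'I_d) (s : R) :
  sym_nonneg M ->
  2 * s * (M *m g) i 0 <= (g^T *m (M *m g)) 0 0 + s ^+ 2 * M i i.
Proof.
move=> [MT M0].
have := M0 (g - s *: basis_vec i).
have Mgi : ((basis_vec i)^T *m (M *m g)) 0 0 = (M *m g) i 0.
  by rewrite /basis_vec trmx_delta -rowE mxE.
have gMi : (g^T *m (M *m basis_vec i)) 0 0 = (M *m g) i 0.
  rewrite -Mgi -[in RHS](mxE trmx_key (fun i j => _ j i)) -/(trmx _).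
  by rewrite !trmx_mul trmxK MT mulmxA.
have iMi : ((basis_vec i)^T *m (M *m basis_vec i)) 0 0 = M i i.
  by rewrite /basis_vec trmx_delta -rowE -colE !mxE.
rewrite [(_ - _)^T]linearB/= [(_ *: _)^T]linearZ/= mulmxBr !mulmxBl.
rewrite -!scalemxAr -!scalemxAl -!mulmxA.
(* The 1 x 1 products are abstracted so that mxE does not expand them into
   sums. *)
move: (g^T *m (M *m g)) ((basis_vec i)^T *m (M *m g)) Mgi.
move: (g^T *m (M *m basis_vec i)) gMi.
move: ((basis_vec i)^T *m (M *m basis_vec i)) iMi.
move: ((M *m g) i 0) => m E EE C CE B D DE.
rewrite !mxE EE CE DE; lra.
Qed.

(** * Displacement along the flow of A grad v *)

Section gradient_like_flow.
Context {R : realType} {d : nat}.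
Variables (A : 'cV[R]_d -> 'M[R]_d) (v : 'cV[R]_d -> R) (gamma : R -> 'cV[R]_d).
Hypothesis A_nonneg : forall y, sym_nonneg (A y).
Hypothesis v1 : Ck 1 v.
Hypothesis gamma_ode : forall t : R,
  is_derive t 1 gamma (A (gamma t) *m grad v (gamma t)).

(** Time integral of [sym_nonneg_coord_le] with [g = grad v]: the energy
    [grad v . A grad v] is the time derivative of [v] along the curve. *)
Lemma displacement_energy_le (i : 'I_d) (C s t : R) :
  (forall y, A y i i <= C) -> 0 <= t ->
  2 * s * (gamma t i 0 - gamma 0 i 0)
    <= v (gamma t) - v (gamma 0) + s ^+ 2 * C * t.
Proof.
move=> AC t0.
pose g (r : R) := v (gamma r) - 2 * s * gamma r i 0 + s ^+ 2 * C * r.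
pose b r := A (gamma r) *m grad v (gamma r).
pose dg r := ((grad v (gamma r))^T *m b r) 0 0 - 2 * s * b r i 0 + s ^+ 2 * C.
have g_deriv (r : R) : is_derive r 1 g (dg r).
  have dv := is_derive_comp_curve v1 (gamma_ode r).
  have di := is_derive_coord i 0 (gamma_ode r).
  have -> : g = (v \o gamma) - (2 * s) *: (fun u => gamma u i 0)
                + (s ^+ 2 * C) *: id by [].
  by apply: is_derive_eq; rewrite /dg [(_ * C) *: _]mulr1.
have [r _ gE] := MVT_segment t0 (fun r _ => g_deriv r)
  (derivable_within_continuous
    (fun r _ => @ex_derive _ _ _ _ _ _ _ (g_deriv r))).
have dg0 : 0 <= dg r.
  have := sym_nonneg_coord_le (grad v (gamma r)) i s (A_nonneg (gamma r)).
  have := ler_wpM2l (sqr_ge0 s) (AC (gamma r)).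
  by rewrite /dg /b; lra.
have : 0 <= g t - g 0 by rewrite gE mulr_ge0// subr0.
by rewrite /g; lra.
Qed.

(** The parameters [s = r] and [s = - r] with [r = 1 / sqrt t] make both terms of
    [displacement_energy_le] bounded in [t], and the two signs bound the absolute
    value. *)
Lemma displacement_rate_le (i : 'I_d) (C M t : R) :
  (forall y, A y i i <= C) -> (forall y, `|v y| <= M) -> 0 < t ->
  `|t^-1 * (gamma t i 0 - gamma 0 i 0)| <= (M + C / 2) * Num.sqrt t^-1.
Proof.
move=> AC vM t0; set r := Num.sqrt t^-1.
have r0 : 0 <= r by exact: sqrtr_ge0.
have rr : r ^+ 2 = t^-1 by rewrite sqr_sqrtr// invr_ge0 ltW.
have rrt : r ^+ 2 * C * t = C by rewrite rr mulrAC mulVf ?mul1r// gt_eqF.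
have vB : v (gamma t) - v (gamma 0) <= 2 * M.
  by have := vM (gamma t); have := vM (gamma 0); rewrite !ler_norml; lra.
have up := displacement_energy_le r AC (ltW t0).
have dn := displacement_energy_le (- r) AC (ltW t0).
rewrite sqrrN !rrt in up dn.
set D := gamma t i 0 - gamma 0 i 0 in up dn *.
rewrite -rr ler_norml; apply/andP; split; nra.
Qed.

End gradient_like_flow.

Lemma cvg_inv_sqrt_bound (R : realType) (a K : R) :
  t^-1 * a + K * Num.sqrt t^-1 @[t --> +oo] --> (0 : R).
Proof.
have inv0 : t^-1 @[t --> +oo] --> (0 : R).
  apply/gtr0_cvgV0; last exact: cvg_id.
  exact: nbhs_pinfty_gt.
have sqrt0 : Num.sqrt t^-1 @[t --> +oo] --> (0 : R).
  rewrite -[X in _ --> X](@sqrtr0 R).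
  by apply: (cvg_comp _ _ inv0); exact: sqrt_continuous.
rewrite -[X in _ --> X]addr0 -[X in _ --> X + _](mul0r a).
rewrite -[X in _ --> _ + X](mulr0 K).
by apply: cvgD; apply: cvgM => //; exact: cvg_cst.
Qed.

Unset Implicit Arguments.

Theorem proposition3p5 (R : realType) (d : nat) (hd : (1 <= d)%N)
    (A : 'cV[R]_d -> 'M[R]_d) (v : 'cV[R]_d -> R)
    (b : 'cV[R]_d -> 'cV[R]_d) (X : R -> 'cV[R]_d -> 'cV[R]_d)
    (hA : Ck_per_mx 1 A) (hApos : forall y : 'cV[R]_d, sym_nonneg (A y))
    (hv : Ck_per 2 v) (hb : forall y : 'cV[R]_d, b y = A y *m grad v y)
    (hX : is_flow b X) :
  forall x : 'cV[R]_d, t^-1 *: X t x @[t --> +oo] --> (0 : 'cV[R]_d).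
Proof.
move=> x; have [X0 Xode] := hX x.
have [[v_cont v_partial] v_per] := hv.
have v1 : Ck 1 v.
  by split=> // i; have [dvi [cvi _]] := v_partial i.
have [M vM] := Zperiodic_bounded v_cont v_per.
have gamma_ode (t : R) : is_derive t 1 (X^~ x) (A (X t x) *m grad v (X t x)).
  by rewrite -hb; exact: Xode.
apply: cvg_mx_coord => i j; rewrite ord1 mxE.
have [[Aii_cont _] Aii_per] := hA i i.
have [C AC] := Zperiodic_bounded Aii_cont Aii_per.
pose K := M + C / 2.
have bound0 := @cvg_inv_sqrt_bound R `|x i 0| K.
apply: (squeeze_cvgr _ _ bound0); last first.
  by rewrite -oppr0; exact: cvgN bound0.
near=> t.
have t0 : 0 < t by near: t; exact: nbhs_pinfty_gt.
rewrite -ler_norml mxE -[X t x i 0](subrK (x i 0)) mulrDr addrC.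
apply: (le_trans (ler_normD _ _)); apply: lerD.
  by rewrite normrM ger0_norm// invr_ge0 ltW.
have -> : x i 0 = X 0 x i 0 by rewrite X0.
apply: (displacement_rate_le (gamma := X^~ x) hApos v1 gamma_ode) => // y.
exact: le_trans (ler_norm _) (AC y).
Unshelve. all: by end_near. Qed.
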